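(* The following statements are equivalent. (a) Every $5$-edge-connected graph is $\mathbb{Z}_3$-connected. (b-i) Every $5$-edge-connected graph is $\mathbb{Z}_3$-extendable at every vertex of degree $5$. (b-ii) Every $5$-edge-connected, essentially $6$-edge-connected graph is $\mathbb{Z}_3$-extendable at every vertex of degree $5$. (c) Every $\mathbb{Z}_3$-reduced graph has minimum degree at most $4$. (d) Every $4$-edge-connected graph with at most five $4$-cuts is $\mathbb{Z}_3$-connected.
   Context: All graphs are finite, without loops, but parallel edges are allowed. For $A\subseteq V(G)$, $\partial_G(A)$ is the set of edges with exactly one end in $A$, and $d_G(A)=|\partial_G(A)|$; $\partial_G(x)=\partial_G(\{x\})$. A $k$-cut is an edge cut $\partial_G(A)$ ($\emptyset\neq A\subsetneq V(G)$) with exactly $k$ edges; ''at most five $4$-cuts'' means at most five distinct such edge sets of size $4$ (trivial cuts, i.e. those isolating a single vertex, included). A graph is essentially $k$-edge-connected if for every $t<k$, every $t$-cut is of the form $\partial(\{v\})$ for a single vertex $v$. A boundary function of $G$ is a map $\beta:V(G)\to\mathbb{Z}_3$ with $\sum_{x\in V(G)}\beta(x)=0$ in $\mathbb{Z}_3$. For such $\beta$, a $\beta$-orientation is an orientation $D$ of $G$ with $d^+_D(v)-d^-_D(v)\equiv\beta(v)\pmod 3$ for all $v$. $G$ is $\mathbb{Z}_3$-connected if it has a $\beta$-orientation for every boundary function $\beta$. $G$ is $\mathbb{Z}_3$-extendable at a vertex $x$ if for every boundary function $\beta$ and every orientation $D_x$ of the edges of $\partial_G(x)$ with $d^+_{D_x}(x)-d^-_{D_x}(x)\equiv\beta(x)\pmod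 3$, $D_x$ extends to a $\beta$-orientation of $G$. $G$ is $\mathbb{Z}_3$-reduced if it contains no $\mathbb{Z}_3$-connected subgraph with at least two vertices. *)

(* Defs.v *)
From mathcomp Require Import all_boot all_algebra.

Set Implicit Arguments.
Unset Strict Implicit.
Unset Printing Implicit Defensive.

Import GRing.Theory.

(* Finite loopless multigraphs. The null graph is allowed: it is Z3-connected,
   has no vertex to extend at, and its min_degree below is 0. *)
Record mgraph := MGraph {
  vert : finType;
  edge : finType;
  ends : edge -> {set vert};
  card_ends : forall e, #|ends e| = 2
}.

Arguments ends {m} e.

Section Graph.
Variable G : mgraph.
Implicit Types (A : {set vert G}) (F C : {set edge G}) (D : edge G -> vert G).
Implicit Types (v x : vert G) (k : nat).

Definition bd A : {set edge G} := [set e | #|ends e :&: A| == 1].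

Definition deg v : nat := #|bd [set v]|.

(* The default #|edge G| bounds every degree, so this is the true minimum as
   soon as G has a vertex. *)
Definition min_degree : nat := \big[minn/#|edge G|]_(v : vert G) deg v.

Definition kcuts k : {set {set edge G}} :=
  [set C : {set edge G} | (#|C| == k) &&
           [exists A : {set vert G}, [&& A != set0, A != setT & C == bd A]]].

Definition edge_connected k : Prop := forall t, t < k -> kcuts t = set0.

Definition ess_edge_connected k : Prop :=
  forall t, t < k -> forall C, C \in kcuts t -> exists v, C = bd [set v].

(* An orientation of the edges of F is given by the tail D e of each e in F;
   values of D outside F are irrelevant. *)
Definition orientation F D : Prop := forall e, e \in F -> D e \in ends e.

Definition outdeg F D v : nat := #|[set e in F | D e == v]|.

Definition indeg F D v : nat :=
  #|[set e in F | (v \in ends e) && (D e != v)]|.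

Definition netdeg F D v : 'Z_3 := ((outdeg F D v)%:R - (indeg F D v)%:R)%R.

Definition boundary (beta : vert G -> 'Z_3) : Prop :=
  (\sum_(x : vert G) beta x = 0)%R.

Definition beta_orientation (beta : vert G -> 'Z_3) D : Prop :=
  orientation [set: edge G] D /\ forall v, netdeg [set: edge G] D v = beta v.

Definition Z3_connected : Prop :=
  forall beta, boundary beta -> exists D, beta_orientation beta D.

Definition Z3_extendable x : Prop :=
  forall beta, boundary beta ->
  forall Dx, orientation (bd [set x]) Dx ->
    netdeg (bd [set x]) Dx x = beta x ->
  exists D, beta_orientation beta D /\ {in bd [set x], D =1 Dx}.

End Graph.

Section Subgraph.
Variables (G : mgraph) (W : {set vert G}) (F : {set edge G}).
Hypothesis sFW : forall e, e \in F -> ends e \subset W.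

Definition sub_ends (e : {e | e \in F}) : {set {x | x \in W}} :=
  [set x | val x \in ends (val e)].

Lemma card_sub_ends e : #|sub_ends e| = 2.
Proof.
rewrite -(card_ends (val e)) -(card_imset _ val_inj); apply: eq_card => x.
apply/imsetP/idP => [[y + ->]|xe]; first by rewrite inE.
by exists (exist _ x (subsetP (sFW (valP e)) x xe)); rewrite ?inE.
Qed.

Definition subgraph : mgraph := MGraph card_sub_ends.

End Subgraph.

Definition Z3_reduced (G : mgraph) : Prop :=
  forall (W : {set vert G}) (F : {set edge G})
         (sFW : forall e, e \in F -> ends e \subset W),
    2 <= #|vert (subgraph sFW)| -> ~ Z3_connected (subgraph sFW).

(* Main.v *)
Require Import Defs.
From mathcomp Require Import all_boot all_algebra.
From mathcomp Require Import zify.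
From Stdlib Require Import Classical_Prop.

(* All five statements are compared with a sixth one, (E): if T is a list of at
   most five vertices of H such that every cut of H together with the items of
   T on either one of its sides counts at least 5, then H is Z3-connected.
   Up to padding T, this says that H + x is 5-edge-connected, where x is a new
   vertex of degree 5 joined to T, and that H = (H + x) - x is Z3-connected.

   (a) => (E): if H has no b-orientation, replace every vertex of K6 by a copy
   of H, attaching the edges of K6 at the items of T. The result is
   5-edge-connected by submodularity. Give each copy the boundary b plus one for
   each edge leaving it; then 2 or 5 of its five K6-edges point outwards, and 5
   is impossible since it would induce a b-orientation of the copy. So exactly 2
   do, which accounts for 12 of the 15 edges of K6 only.
   (E) => (b-i): apply (E) to G - x.
   (E) => (c): a minimal nonempty A with d(A) <= 4 in a graph of minimum degree
   at least 5 has two vertices, and (E) applies to G[A].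
   (E) => (d): the minimal sides of 4-cuts are disjoint, hence at most five of
   them; T picks a vertex in each.
   (b-ii) => (E): if H + x has a nontrivial 5-cut with side B not containing x,
   then H[B] and H / B are Z3-connected by induction.
   (c) => (a): contract a nontrivial Z3-connected subgraph, by induction. *)

Set Implicit Arguments.
Unset Strict Implicit.
Unset Printing Implicit Defensive.

Import GRing.Theory.
Local Open Scope nat_scope.

(** * Edge cuts and net degrees *)

Lemma sum_mem_card (T : finType) (A : {pred T}) (P : pred T) :
  \sum_(x in A) (P x : nat) = #|[set x in A | P x]|.
Proof.
by rewrite -sum1dep_card big_mkcondr; apply: eq_bigr => x _; case: (P x).
Qed.

Lemma pair_in_exact (T : finType) (A : {set T}) (a b : T) : a != b ->
  (#|[set a; b] :&: A| == 1) = (a \in A) (+) (b \in A).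
Proof.
move=> ab; rewrite setIUl cardsU.
have c1 x : #|[set x] :&: A| = (x \in A).
  case: (boolP (x \in A)) => xA; first by rewrite (setIidPl _) ?cards1 ?sub1set.
  by apply/eqP; rewrite cards_eq0 setI_eq0 disjoints1.
have -> : [set a] :&: A :&: ([set b] :&: A) = set0.
  by apply/setP=> x; rewrite !inE; case: eqP => // ->; rewrite (negbTE ab) andbF.
by rewrite !c1 cards0 subn0; do 2 case: (_ \in A).
Qed.

Section Basics.
Variable G : mgraph.
Implicit Types (A B : {set vert G}) (D : edge G -> vert G) (e : edge G).

Lemma ends_pair e : exists u v, u != v /\ ends e = [set u; v].
Proof. by apply/cards2P; rewrite card_ends. Qed.

Lemma ends_neq0 e : exists v, v \in ends e.
Proof. by have [u [v [_ ->]]] := ends_pair e; exists u; rewrite !inE eqxx. Qed.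

Definition an_end e : vert G := xchoose (ends_neq0 e).

Lemma an_endP e : an_end e \in ends e.
Proof. exact: (xchooseP (ends_neq0 e)). Qed.

Lemma in_bd A e u v : u != v -> ends e = [set u; v] ->
  (e \in bd A) = (u \in A) (+) (v \in A).
Proof. by move=> uv ev; rewrite inE ev pair_in_exact. Qed.

Lemma in_bd1 x e : (e \in bd [set x]) = (x \in ends e).
Proof.
have [u [v [uv ee]]] := ends_pair e; rewrite (in_bd _ uv ee) ee !inE.
rewrite !(eq_sym x); case: eqP => [<-|_]; first by rewrite eq_sym (negbTE uv).
by rewrite addFb.
Qed.

Lemma bdC A : bd (~: A) = bd A.
Proof.
apply/setP=> e; have [u [v [uv ee]]] := ends_pair e.
by rewrite !(in_bd _ uv ee) !inE; do 2 case: (_ \in A).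
Qed.

Lemma bd0 : bd (set0 : {set vert G}) = set0.
Proof.
apply/setP=> e; have [u [v [uv ee]]] := ends_pair e.
by rewrite (in_bd _ uv ee) !inE.
Qed.

Lemma bdT : bd [set: vert G] = set0.
Proof. by rewrite -setC0 bdC bd0. Qed.

Lemma card_bdE A : #|bd A| = \sum_e (e \in bd A : nat).
Proof. by rewrite -sum1_card big_mkcond; apply: eq_bigr => e _; case: ifP. Qed.

(** Holds edge by edge; only an edge between [A :\: B] and [B :\: A] makes it strict. *)
Lemma bd_submod A B : #|bd (A :&: B)| + #|bd (A :|: B)| <= #|bd A| + #|bd B|.
Proof.
rewrite !card_bdE -!big_split; apply: leq_sum => e _ /=.
have [u [v [uv ee]]] := ends_pair e; rewrite !(in_bd _ uv ee) !inE.
by do 2 case: (_ \in A); do 2 case: (_ \in B).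
Qed.

Lemma edge_connectedP k : edge_connected G k <->
  forall A, A != set0 -> A != setT -> k <= #|bd A|.
Proof.
split=> [ec A A0 AT | ec t tk].
  rewrite leqNgt; apply/negP => /ec /setP /(_ (bd A)).
  by rewrite !inE eqxx => /existsP []; exists A; rewrite A0 AT eqxx.
apply/setP=> C; rewrite !inE; apply/negP.
case/andP=> /eqP Ct /existsP[A /and3P[A0 AT /eqP eC]].
by have := ec A A0 AT; rewrite -eC Ct leqNgt tk.
Qed.

(** The contribution of one edge to the net degree: 1 at its tail, -1 at its other end and 0
    elsewhere, as long as [D e] is an end of [e]. *)
Definition flow D e v : 'Z_3 :=
  ((D e == v)%:R - ((v \in ends e) && (D e != v))%:R)%R.

Lemma netdegE (F : {set edge G}) D v :
  netdeg F D v = (\sum_(e in F) flow D e v)%R.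
Proof.
by rewrite /netdeg /outdeg /indeg -!sum_mem_card !natr_sum sumrB.
Qed.

Lemma netdegTE D v : netdeg [set: edge G] D v = (\sum_e flow D e v)%R.
Proof. by rewrite netdegE; apply: eq_bigl => e; rewrite inE. Qed.

Lemma flow_notin D e v : D e \in ends e -> v \notin ends e -> flow D e v = 0%R.
Proof.
move=> De ve; rewrite /flow (negbTE ve) /= subr0.
by case: eqP => // Dv; rewrite -Dv De in ve.
Qed.

Lemma sum_flow D e : D e \in ends e -> (\sum_v flow D e v = 0)%R.
Proof.
move=> De; rewrite /flow sumrB -!natr_sum.
have -> : \sum_v (D e == v : nat) = 1.
  by rewrite (bigD1 (D e)) //= eqxx big1 // => v; rewrite eq_sym => /negbTE ->.
have := card_ends e; rewrite (cardsD1 (D e)) De add1n => -[].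
rewrite (_ : #|_| = \sum_v ((v \in ends e) && (D e != v) : nat)) => [->|].
  exact: subrr.
rewrite -sum1_card big_mkcond; apply: eq_bigr => v _.
by rewrite !inE eq_sym andbC; case: ifP.
Qed.

Lemma sum_netdeg (F : {set edge G}) D : orientation F D ->
  (\sum_v netdeg F D v = 0)%R.
Proof.
move=> oD; under eq_bigr do rewrite netdegE.
by rewrite exchange_big big1 //= => e /oD; apply: sum_flow.
Qed.

Lemma eq_flow D D' e v : D e = D' e -> flow D e v = flow D' e v.
Proof. by rewrite /flow => ->. Qed.

Lemma eq_in_netdeg (F : {set edge G}) D D' v :
  {in F, D =1 D'} -> netdeg F D v = netdeg F D' v.
Proof. by move=> DD; rewrite !netdegE; apply: eq_bigr => e /DD; apply: eq_flow. Qed.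

End Basics.

(** There is no edge, and the zero sum makes [beta] vanish on the only possible vertex. *)
Lemma Z3_connected_small (G : mgraph) : #|vert G| <= 1 -> Z3_connected G.
Proof.
move=> V1 beta bb.
have noe (e : edge G) : False.
  by have := leq_trans (max_card (mem (ends e))) V1; rewrite card_ends.
exists (@an_end G); split=> [e|v]; first by case: (noe e).
rewrite netdegTE big1 => [|e]; last by case: (noe e).
rewrite -bb (bigD1 v) //= big1 ?addr0 // => w wv.
by have := fintype_le1P V1 w v => wE; rewrite wE eqxx in wv.
Qed.

(** * Completing a partial orientation inside a subgraph *)

Section Subgraph.
Variables (G : mgraph) (W : {set vert G}) (F : {set edge G}).
Hypothesis sFW : forall e, e \in F -> ends e \subset W.
Let H := subgraph sFW.

(** What [beta] still demands after [D0] sums to zero and vanishes outside [W], so it restricts to a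
    boundary function of [H], which [H] can realize. *)
Lemma Z3_connected_extend (beta : vert G -> 'Z_3) (D0 : edge G -> vert G) :
    Z3_connected H -> boundary beta -> orientation (~: F) D0 ->
    (forall v, v \notin W -> netdeg (~: F) D0 v = beta v) ->
  exists D, beta_orientation beta D /\ {in ~: F, D =1 D0}.
Proof.
move=> ZH bb oD0 nD0.
pose b' (v : vert H) : 'Z_3 := (beta (val v) - netdeg (~: F) D0 (val v))%R.
have bb' : boundary b'.
  rewrite /boundary /b' -(big_sub (mem W) (fun v => beta v - netdeg (~: F) D0 v)%R).
  have : (\sum_v (beta v - netdeg (~: F) D0 v) = 0)%R.
    by rewrite sumrB bb sum_netdeg ?subrr.
  rewrite (bigID (mem W) xpredT) /= [X in (_ + X)%R]big1 ?addr0 // => v /nD0 ->.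
  exact: subrr.
have [D' [oD' nD']] := ZH _ bb'.
pose D e := if insub e is Some e' then val (D' e') else D0 e.
have DF (e : edge H) : D (val e) = val (D' e) by rewrite /D valK.
have DC : {in ~: F, D =1 D0}.
  by move=> e; rewrite inE => eF; rewrite /D insubN.
have flowF (e : edge H) v : flow D (val e) (val v) = flow D' e v.
  by rewrite /flow DF val_eqE inE.
have oD : orientation [set: edge G] D.
  move=> e _; case: (boolP (e \in F)) => eF.
    by have := oD' (exist _ e eF) (in_setT _); rewrite inE -DF.
  by rewrite DC ?inE //; apply: oD0; rewrite inE.
exists D; split=> //; split=> // v.
have spl : netdeg [set: edge G] D v = (netdeg F D v + netdeg (~: F) D v)%R.
  rewrite netdegTE (bigID (mem F)) !netdegE /=; congr (_ + _)%R.
  by apply: eq_bigl => e; rewrite inE.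
rewrite spl (eq_in_netdeg _ DC).
case: (boolP (v \in W)) => vW; last first.
  rewrite nD0 // netdegE big1 ?add0r // => e eF.
  apply: flow_notin; first exact: oD.
  by apply: contra vW; apply: subsetP; apply: sFW.
have := nD' (exist _ v vW); rewrite netdegTE /b' /= => nv.
rewrite netdegE (big_sub (mem F)) (eq_bigr (fun e => flow D' e (exist _ v vW))).
  by rewrite nv subrK.
by move=> e _; rewrite -flowF.
Qed.
End Subgraph.

(** * Contraction of a vertex set *)

Lemma card_imset_capl (T U : finType) (f : T -> U) (E : {set T}) (S : {set U}) :
  {in E &, injective f} -> #|f @: E :&: S| = #|E :&: f @^-1: S|.
Proof.
move=> fI; rewrite -(card_in_imset (f := f) (D := E :&: f @^-1: S)); last first.
  by move=> x y; rewrite !inE => /andP[xE _] /andP[yE _]; apply: fI.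
apply: eq_card => y; rewrite !inE; apply/andP/imsetP.
  by move=> [/imsetP[x xE ->] xS]; exists x; rewrite ?inE ?xE.
by move=> [x]; rewrite !inE => /andP[xE xS] ->; rewrite imset_f.
Qed.

Lemma setC_eq0 (T : finType) (A : {set T}) : (~: A == set0) = (A == setT).
Proof. by rewrite -(inj_eq (@setC_inj T) A) setCT. Qed.

Section Contract.
Variables (G : mgraph) (B : {set vert G}).

(** [None] is the vertex to which [B] shrinks. It exists even for empty [B], hence the assumptions
    [B != set0] below. Edges inside [B] would become loops and are dropped. *)
Definition contract_vert : finType := option {x | x \notin B}.
Definition contract_edge : finType := {e : edge G | ~~ (ends e \subset B)}.
Definition contract_map (x : vert G) : contract_vert := insub x.

Lemma contract_map_Some (x : vert G) (y : {x | x \notin B}) :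
  (contract_map x == Some y) = (x == val y).
Proof.
rewrite /contract_map; case: insubP => [u _ <-|]; first by [].
by rewrite negbK => xB; apply/esym/eqP => xy; move: (valP y); rewrite -xy xB.
Qed.

Lemma contract_map_inj (e : edge G) : ~~ (ends e \subset B) ->
  {in ends e &, injective contract_map}.
Proof.
move=> eB x y xe ye; rewrite /contract_map.
case: insubP => [u _ <-|]; first by move/esym/eqP; rewrite contract_map_Some => /eqP.
case: insubP => // /negPn yB /negPn xB _; apply/eqP; apply: contraNT eB => xy.
suff -> : ends e = [set x; y] by rewrite subUset !sub1set xB yB.
by apply/esym/eqP; rewrite eqEcard subUset !sub1set xe ye card_ends cards2 xy.
Qed.

Definition contract_ends (e : contract_edge) : {set contract_vert} :=
  contract_map @: ends (val e).

Lemma card_contract_ends e : #|contract_ends e| = 2.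
Proof. by rewrite card_in_imset ?card_ends //; apply: contract_map_inj (valP e). Qed.

Definition contract : mgraph := MGraph card_contract_ends.

(** Cuts of the contraction are the cuts of [G] that keep [B] on one side; the dropped edges cross
    none of them. *)
Lemma card_bd_contract (S : {set vert contract}) :
  #|bd S| = #|bd (contract_map @^-1: S)|.
Proof.
rewrite -(card_imset _ val_inj); apply: eq_card => e; apply/imsetP/idP.
  move=> [e' + ->]; rewrite !inE /= card_imset_capl //.
  exact: contract_map_inj (valP e').
move=> eS; suff eB : ~~ (ends e \subset B).
  exists (exist _ e eB) => //; move: eS; rewrite !inE /= card_imset_capl //.
  exact: contract_map_inj.
apply: contraL eS => eB; have [u [v [uv ee]]] := ends_pair e.
rewrite (in_bd _ uv ee) !inE.
have cN w : w \in ends e -> contract_map w = None.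
  by move/(subsetP eB) => wB; rewrite /contract_map insubN // wB.
by rewrite !cN ?addbb // ee !inE eqxx ?orbT.
Qed.

Lemma contract_preim_neq0 (S : {set vert contract}) :
  B != set0 -> S != set0 -> contract_map @^-1: S != set0.
Proof.
move=> /set0Pn[b bB] /set0Pn[[y|] yS]; apply/set0Pn.
  by exists (val y); rewrite inE /contract_map valK.
by exists b; rewrite inE /contract_map insubN // bB.
Qed.

Lemma contract_preim_neqT (S : {set vert contract}) :
  B != set0 -> S != setT -> contract_map @^-1: S != setT.
Proof.
move=> B0; rewrite -setC_eq0 => /(contract_preim_neq0 B0).
by rewrite preimsetC setC_eq0.
Qed.

Lemma card_contract : #|vert contract| = (#|vert G| - #|B|).+1.
Proof.
rewrite card_option card_sig -[B in RHS]setCK -cardsCs; congr _.+1.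
by apply: eq_card => x; rewrite !inE.
Qed.

Lemma edge_connected_contract k :
  B != set0 -> edge_connected G k -> edge_connected contract k.
Proof.
move=> B0 /edge_connectedP ec; apply/edge_connectedP => S S0 ST.
by rewrite card_bd_contract ec ?contract_preim_neq0 ?contract_preim_neqT.
Qed.

(** Orient the contraction for the boundary summed over fibres and lift this to [G]: all vertices
    outside [B] are then satisfied, and the subgraph on [F] repairs those of [B]. *)
Lemma Z3_connected_contract (F : {set edge G})
    (sFB : forall e, e \in F -> ends e \subset B) :
  Z3_connected (subgraph sFB) -> Z3_connected contract -> Z3_connected G.
Proof.
move=> ZF ZC beta bb.
pose b' (w : vert contract) : 'Z_3 := (\sum_(v | contract_map v == w) beta v)%R.
have bb' : boundary b'.
  rewrite /boundary /b' -[RHS]bb.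
  by rewrite (partition_big contract_map xpredT).
have [D' [oD' nD']] := ZC _ bb'.
(* The lifted tail is the end of [e] lying over the tail of its image; the default of the inner
   choice is never reached. Edges inside [B] are oriented arbitrarily. *)
pose D0 (e : edge G) : vert G := if insub e is Some e'
  then odflt (an_end e) [pick v in ends e | contract_map v == D' e'] else an_end e.
have D0P (e : edge contract) :
    D0 (val e) \in ends (val e) /\ contract_map (D0 (val e)) = D' e.
  rewrite /D0 valK; case: pickP => [v /andP[ve /eqP vD]//|no].
  have /imsetP[v ve vD] : D' e \in ends e by apply: oD'.
  by have := no v; rewrite /= ve vD eqxx.
have oD0 e : D0 e \in ends e.
  case: (boolP (ends e \subset B)) => [eB|eB]; last by case: (D0P (exist _ e eB)).
  by rewrite /D0 insubN ?negbK // an_endP.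
have flow0 (e : edge contract) (v : {x | x \notin B}) :
    flow D0 (val e) (val v) = flow D' e (Some v).
  rewrite /flow; have [_ <-] := D0P e; rewrite contract_map_Some.
  suff -> : (Some v \in ends e) = (val v \in ends (val e)) by [].
  apply/imsetP/idP => [[x xe /esym/eqP]|ve].
    by rewrite contract_map_Some => /eqP <-.
  by exists (val v); rewrite // /contract_map valK.
have nD0 v : v \notin B -> netdeg (~: F) D0 v = beta v.
  move=> vB; have := nD' (Some (exist _ v vB)); rewrite netdegTE /b'.
  rewrite (big_pred1 v) => [<-|x]; last by rewrite contract_map_Some.
  rewrite netdegE (eq_bigr (fun e => flow D0 (val e) v)); last first.
    by move=> e _; rewrite -flow0.
  rewrite -(big_sub [pred e : edge G | ~~ (ends e \subset B)] (fun e => flow D0 e v)).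
  have fB e : ends e \subset B -> flow D0 e v = 0%R.
    by move=> eB; apply: flow_notin => //; apply: contra vB; apply: subsetP.
  rewrite [RHS]big_mkcond [LHS]big_mkcond; apply: eq_bigr => e _ /=.
  rewrite !inE; case: (boolP (e \in F)) => [/sFB eB|_] /=; first by rewrite eB.
  by case: (boolP (ends e \subset B)) => [/fB|].
have [D [bD _]] := Z3_connected_extend ZF bb (fun e _ => oD0 e) nD0.
by exists D.
Qed.

End Contract.

(** * Induced subgraphs with pending edges *)

Section Induced.
Variables (G : mgraph) (A : {set vert G}).

Lemma induced_subset (e : edge G) :
  e \in [set e | ends e \subset A] -> ends e \subset A.
Proof. by rewrite inE. Qed.

Definition induced : mgraph := subgraph induced_subset.

Lemma card_induced : #|vert induced| = #|A|.
Proof. by rewrite card_sig; apply: eq_card => x; rewrite !inE. Qed.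

(** An edge leaving [C] in [G] either stays inside [A] or also leaves [A]. *)
Lemma card_bd_induced (C : {set vert induced}) :
  #|bd (val @: C)| = #|bd C| + #|[set e in bd A | e \in bd (val @: C)]|.
Proof.
have CA x : x \in val @: C -> x \in A by move=> /imsetP[y _ ->]; apply: valP.
rewrite -(cardsID [set e | ends e \subset A] (bd (val @: C))); congr (_ + _).
  rewrite -(card_imset (bd C) val_inj); apply: eq_card => e; apply/idP/imsetP.
    rewrite !inE => /andP[eC eA].
    have eA' : e \in [set e | ends e \subset A] by rewrite inE.
    exists (exist _ e eA') => //; rewrite inE -(eqP eC) -(card_imset _ val_inj).
    apply/eqP; apply: eq_card => x; apply/imsetP/idP.
      by move=> [y]; rewrite !inE => /andP[ye yC] ->; rewrite ye imset_f.
    rewrite inE => /andP[xe /imsetP[y yC xy]]; exists y => //.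
    by rewrite !inE /= -xy xe.
  move=> [e']; rewrite inE => /eqP eC ->; rewrite !inE; apply/andP; split; last first.
    exact: induced_subset (valP e').
  rewrite -eC -(card_imset _ val_inj) /=; apply/eqP; apply: eq_card => x.
  apply/idP/imsetP.
    rewrite inE => /andP[xe /imsetP[y yC xy]]; exists y => //.
    by rewrite !inE /= -xy xe.
  by move=> [y]; rewrite !inE => /andP[ye yC] ->; rewrite ye imset_f.
apply: eq_card => e; rewrite [RHS]inE [LHS]inE andbC [RHS]andbC.
have [u [v [uv ee]]] := ends_pair e; rewrite inE !(in_bd _ uv ee) ee.
rewrite subUset !sub1set.
case: (boolP (u \in val @: C)) => [/CA ->|_];
  case: (boolP (v \in val @: C)) => [/CA ->|_] //=; by case: (_ \in A).
Qed.

End Induced.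

(** The size of the cut around [B] once a new vertex is joined to the items of [T]. *)
Definition cut_weight (G : mgraph) (T : seq (vert G)) (B : {set vert G}) : nat :=
  #|bd B| + count (mem B) T.

(* [T] lists the vertices of [G] carrying a pending edge, with multiplicity:
   joining all of them to a new vertex makes [G] 5-edge-connected, up to the
   degree of that vertex. *)
Definition stubbed5 (G : mgraph) (T : seq (vert G)) : Prop :=
  forall B : {set vert G}, B != set0 -> B != setT -> 5 <= cut_weight T B.

Lemma cut_weightT (G : mgraph) (T : seq (vert G)) : cut_weight T setT = size T.
Proof.
rewrite /cut_weight bdT cards0 (eq_count (a2 := xpredT)) ?count_predT // => x.
by rewrite /= inE.
Qed.

Lemma count_pmap (T1 T2 : Type) (f : T1 -> option T2) (a : pred T2) (s : seq T1) :
  count a (pmap f s) = count (fun x => oapp a false (f x)) s.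
Proof. by elim: s => //= x s IH; case: (f x) => /= [y|]; rewrite IH. Qed.

(** Everything outside [A], the pending side included, is merged into one new vertex: [T'] lists the
    inner ends of the edges leaving [A], then the items of [T] in [A]. *)
Lemma induced_stubs (G : mgraph) (T : seq (vert G)) (A : {set vert G}) :
  exists T' : seq (vert (induced A)), size T' <= cut_weight T A /\
    forall C : {set vert (induced A)}, cut_weight T' C = cut_weight T (val @: C).
Proof.
pose f (e : edge G) := [pick x : vert (induced A) | val x \in ends e].
pose g (x : vert G) : option (vert (induced A)) := insub x.
exists (pmap f (enum (bd A)) ++ pmap g T); split=> [|C].
  rewrite size_cat leq_add //.
    by rewrite size_pmap (leq_trans (count_size _ _)) // -cardE.
  rewrite size_pmap; apply: sub_count => x /=.
  by rewrite /g; case: insubP.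
rewrite /cut_weight count_cat card_bd_induced -addnA; congr (_ + (_ + _)).
  rewrite count_pmap.
  have -> : #|[set e in bd A | e \in bd (val @: C)]| =
      count (mem (bd (val @: C))) (enum (bd A)).
    rewrite -sum1_card -sum1_count big_enum_cond /=.
    by apply: eq_bigl => e; rewrite inE.
  apply: eq_in_count => e; rewrite mem_enum => eA /=.
  have [u [v [uv ee]]] := ends_pair e; rewrite (in_bd _ uv ee).
  wlog uA : u v uv ee / u \in A.
    case: (boolP (u \in A)) => uA W; first exact: W.
    rewrite addbC; apply: W; rewrite ?(eq_sym v) // ?(setUC [set v]) //.
    by move: eA; rewrite (in_bd _ uv ee) (negbTE uA).
  have vA : v \notin A by move: eA; rewrite (in_bd _ uv ee) uA.
  have -> : (v \in val @: C) = false.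
    by apply: contraNF vA => /imsetP[y _ ->]; apply: valP.
  rewrite addbF /f; case: pickP => [x|/(_ (exist _ u uA))]; last first.
    by rewrite /= ee !inE eqxx.
  rewrite ee !inE => /orP[] /eqP xu /=; first by rewrite -xu mem_imset //; apply: val_inj.
  by move: (valP x); rewrite xu (negbTE vA).
rewrite count_pmap; apply: eq_count => x /=; rewrite /g.
case: insubP => [y _ <-|xA] /=; first by rewrite mem_imset //; apply: val_inj.
by apply/esym; apply: contraNF xA => /imsetP[y _ ->]; apply: valP.
Qed.

(** Statement (E) for graphs with at most [n] vertices, so that it can be proved by induction on
    [n]. *)
Definition stub_connected (n : nat) : Prop :=
  forall (H : mgraph) (T : seq (vert H)), #|vert H| <= n -> size T <= 5 ->
    stubbed5 T -> Z3_connected H.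

(** The form in which (E) is applied: the weight of [A] bounds the number of stubs of [induced A],
    and cut weights in it are those of proper subsets of [A]. *)
Lemma induced_Z3_connected (G : mgraph) (T : seq (vert G)) (A : {set vert G}) :
    stub_connected #|A| -> cut_weight T A <= 5 ->
    (forall B : {set vert G}, B != set0 -> B \proper A -> 5 <= cut_weight T B) ->
  Z3_connected (induced A).
Proof.
move=> E wA wB; have [T' [sT' wT']] := induced_stubs T A.
apply: (E _ T'); rewrite ?card_induced ?(leq_trans sT') // => C C0 CT.
rewrite wT'; apply: wB.
  by have [x xC] := set0Pn _ C0; apply/set0Pn; exists (val x); apply: imset_f.
rewrite properE; apply/andP; split.
  by apply/subsetP => x /imsetP[y _ ->]; apply: valP.
apply: contra CT => AC; apply/eqP/setP => y; rewrite inE.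
by have := subsetP AC _ (valP y); rewrite mem_imset //; apply: val_inj.
Qed.

(** * Consequences of (E) *)

Lemma bigmin_leq_id (I : Type) (s : seq I) (d : nat) (f : I -> nat) :
  \big[minn/d]_(i <- s) f i <= d.
Proof.
elim: s => [|i s IH]; first by rewrite big_nil.
by rewrite big_cons geq_min IH orbT.
Qed.

Lemma bigmin_leq_seq (I : eqType) (s : seq I) (d : nat) (f : I -> nat) (i : I) :
  i \in s -> \big[minn/d]_(i <- s) f i <= f i.
Proof.
elim: s => // j s IH; rewrite inE big_cons geq_min => /orP[/eqP ->|/IH ->].
  by rewrite leqnn.
by rewrite orbT.
Qed.

Section Applications.
Hypothesis E : forall n, stub_connected n.

(** By (E), with the five edges at [x] as stubs, [G] minus [x] is Z3-connected, so it completes any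
    prescribed orientation of these edges. *)
Lemma stub_extendable (G : mgraph) (x : vert G) :
  edge_connected G 5 -> deg x = 5 -> Z3_extendable x.
Proof.
move=> /edge_connectedP ec dx.
have Z : Z3_connected (induced (~: [set x])).
  apply: (@induced_Z3_connected _ [::]) => // [|B B0 BA].
    by rewrite /cut_weight /= bdC addn0 -/(deg x) dx.
  rewrite /cut_weight addn0 ec //; apply: contraTneq BA => ->.
  by rewrite properE subTset; apply/nandP; right; rewrite subsetT.
move=> beta bb Dx oDx nDx.
have FE : ~: [set e | ends e \subset ~: [set x]] = bd [set x].
  by apply/setP=> e; rewrite in_bd1 !inE subsetC sub1set inE negbK.
have := Z3_connected_extend (D0 := Dx) Z bb; rewrite FE; apply=> // v.
by rewrite !inE negbK => /eqP ->.
Qed.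

Lemma stub_min_degree (G : mgraph) : Z3_reduced G -> min_degree G <= 4.
Proof.
move=> red; rewrite leqNgt; apply/negP => md.
have dv (v : vert G) : 5 <= deg v.
  by exact: leq_trans md (bigmin_leq_seq _ (@deg G) (mem_index_enum v)).
pose P (A : {set vert G}) := (A != set0) && (#|bd A| <= 4).
have PT : P setT.
  rewrite /P bdT cards0 andbT; apply/set0Pn.
  (* The minimum never exceeds its default [#|edge G|], so [md] provides an edge and hence a
     vertex. *)
  have : 0 < #|edge G|.
    apply: leq_trans (leq_trans (_ : _ <= 5) md) _ => //.
    exact: bigmin_leq_id.
  by case/card_gt0P => e _; exists (an_end e).
have [A /minsetP[/andP[A0 dA] minA] _] := minset_exists PT.
have BA B : B != set0 -> B \proper A -> 5 <= #|bd B|.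
  move=> B0 BA; rewrite ltnNge; apply/negP => dB.
  have := minA B; rewrite /P B0 dB (proper_sub BA) => /(_ isT isT) eBA.
  by rewrite eBA properxx in BA.
apply: (red _ _ (@induced_subset G A)); last first.
  apply: (@induced_Z3_connected _ [::]) => // [|B B0 /BA]; rewrite /cut_weight addn0.
    exact: leq_trans dA _.
  by apply.
(* A singleton [A] would be a vertex of degree at most 4. *)
rewrite -/(induced A) card_induced ltn_neqAle card_gt0 A0 andbT eq_sym.
apply/negP => /cards1P[v Av]; have := dv v; rewrite /deg -Av leqNgt ltnS.
by rewrite dA.
Qed.

Lemma stub_few_4cuts (G : mgraph) :
  edge_connected G 4 -> #|kcuts G 4| <= 5 -> Z3_connected G.
Proof.
move=> /edge_connectedP ec k5.
case: (posnP #|vert G|) => [V0|/card_gt0P[v0 _]].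
  by apply: Z3_connected_small; rewrite V0.
pose P (A : {set vert G}) := [&& A != set0, A != setT & #|bd A| == 4].
pose M := [set A | minset P A].
have MP A : A \in M -> P A by rewrite inE => /minsetp.
have Mmin A B : A \in M -> P B -> B \subset A -> B = A.
  by rewrite inE => /minsetP[_ m] PB BA; apply: m.
(* Uncrossing: if the union is not everything, submodularity makes [A :&: B] a side of a 4-cut,
   against minimality; otherwise [~: A] is such a side inside [B], so it equals [B]. *)
have disj A B : A \in M -> B \in M -> A != B -> A :&: B = set0.
  move=> MA MB; apply: contraNeq => AB0.
  have /and3P[A0 AT /eqP dA] := MP _ MA; have /and3P[B0 BT /eqP dB] := MP _ MB.
  case: (eqVneq (A :|: B) setT) => ABT.
    have PC : P (~: A).
      rewrite /P bdC dA eqxx setC_eq0 AT andbT /= -(inj_eq (@setC_inj _)) setCK setCT.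
      by rewrite A0.
    have CB : ~: A \subset B by rewrite -setTD subDset ABT.
    by have BE := Mmin _ _ MB PC CB; rewrite -BE setICr eqxx in AB0.
  have PI : P (A :&: B).
    rewrite /P AB0 /=; apply/andP; split.
      by apply: contra AT; rewrite -!subTset subsetI => /andP[].
    rewrite eqn_leq ec ?andbT //; last first.
      by apply: contra AT; rewrite -!subTset subsetI => /andP[].
    have := bd_submod A B; rewrite dA dB.
    have : 4 <= #|bd (A :|: B)|.
      by apply: ec => //; rewrite setU_eq0 negb_and A0.
    lia.
  by rewrite -(Mmin _ _ MA PI (subsetIl _ _)) (Mmin _ _ MB PI (subsetIr _ _)).
have M5 : #|M| <= 5.
  case: (boolP (dinjectiveb (@bd G) (mem M))) => [/dinjectiveP bdI|].
    rewrite -(card_in_imset bdI); apply: leq_trans k5; apply: subset_leq_card.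
    apply/subsetP => _ /imsetP[A /MP/and3P[A0 AT dA] ->]; rewrite inE dA.
    by apply/existsP; exists A; rewrite A0 AT /=.
  (* Two disjoint minimal sides with the same cut have a union with empty boundary, so they cover
     the graph and leave no room for a third. *)
  case/dinjectivePn => A MA [B /andP[BA MB] dAB].
  have AB0 : A :&: B = set0 by apply: disj => //; rewrite eq_sym.
  have bdU0 : bd (A :|: B) = set0.
    apply/setP => e; have [u [v [uv ee]]] := ends_pair e.
    have := congr1 (fun C : {set edge G} => e \in C) dAB.
    rewrite /= !(in_bd _ uv ee) !inE.
    have := congr1 (fun C : {set vert G} => u \in C) AB0.
    have := congr1 (fun C : {set vert G} => v \in C) AB0; rewrite /= !inE.
    by do 2 case: (_ \in A); do 2 case: (_ \in B).
  have /and3P[A0 _ _] := MP _ MA.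
  have ABT : A :|: B = setT.
    apply/eqP; apply: contraT => ABT.
    by have := ec _ _ ABT; rewrite bdU0 cards0 setU_eq0 negb_and A0 => /(_ isT).
  suff MS : M \subset [set A; B].
    by apply: leq_trans (subset_leq_card MS) _; rewrite cards2; case: (_ != _).
  apply/subsetP => C MC; rewrite !inE; apply: contraT; rewrite negb_or => /andP[CA CB].
  have /and3P[/negP[]] := MP _ MC.
  by rewrite -(setIT C) -ABT setIUr (disj _ _ MC MA CA) (disj _ _ MC MB CB) setU0.
pose rep (A : {set vert G}) := odflt v0 [pick x in A].
apply: (E (T := [seq rep A | A <- enum M]) (leqnn _)).
  by rewrite size_map -cardE.
move=> B B0 BT; rewrite /cut_weight.
(* Only sides of 4-cuts need a stub, and each of them contains a minimal side together with its
   representative. *)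
case: (eqVneq #|bd B| 4) => dB; last by have := ec B B0 BT; lia.
have PB : P B by rewrite /P B0 BT dB eqxx.
have [A mA AB] := minset_exists PB.
rewrite dB -[5]/(4 + 1) leq_add2l -has_count; apply/hasP; exists (rep A).
  by apply: map_f; rewrite mem_enum inE.
have /and3P[/set0Pn[x xA] _ _] := minsetp mA.
apply: (subsetP AB); rewrite /rep; case: pickP => [y yA //|/(_ x)].
by rewrite xA.
Qed.

End Applications.

(** * Adding a new vertex joined to the stubs *)

Lemma stubbed5_contract (G : mgraph) (T : seq (vert G)) (B : {set vert G}) :
  B != set0 -> stubbed5 T -> stubbed5 (map (contract_map B) T : seq (vert (contract B))).
Proof.
move=> B0 sT S S0 ST; rewrite /cut_weight card_bd_contract count_map.
rewrite (eq_count (a2 := mem (contract_map B @^-1: S))); last by move=> x; rewrite /= inE.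
by apply: sT; rewrite ?contract_preim_neq0 ?contract_preim_neqT.
Qed.

(** More stubs only raise weights; exactly five give the new vertex degree 5. *)
Lemma pad_stubs (G : mgraph) (v : vert G) (T : seq (vert G)) :
  size T <= 5 -> stubbed5 T -> exists2 T' : seq (vert G), size T' = 5 & stubbed5 T'.
Proof.
move=> sT wT; exists (T ++ nseq (5 - size T) v).
  by rewrite size_cat size_nseq subnKC.
move=> B B0 BT; apply: leq_trans (wT B B0 BT) _.
by rewrite /cut_weight count_cat addnA leq_addr.
Qed.

Section AddVertex.
Variables (H : mgraph) (T : seq (vert H)).

Definition apex_ends (e : edge H + 'I_(size T)) : {set option (vert H)} :=
  match e with
  | inl e => Some @: ends e
  | inr j => [set None; Some (tnth (in_tuple T) j)]
  end.

Lemma card_apex_ends e : #|apex_ends e| = 2.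
Proof.
case: e => [e|j] /=; last by rewrite cards2.
by rewrite card_imset ?card_ends //; apply: Some_inj.
Qed.

Definition add_apex : mgraph := MGraph card_apex_ends.

Lemma card_bd_apex (A : {set vert add_apex}) :
  None \notin A -> #|bd A| = cut_weight T (Some @^-1: A).
Proof.
move=> NA; rewrite card_bdE big_sumType /cut_weight card_bdE; congr (_ + _).
  apply: eq_bigr => e _; rewrite !inE /= card_imset_capl //.
  by move=> x y _ _; apply: Some_inj.
rewrite -sum1_count [RHS]big_tnth [RHS]big_mkcond /=; apply: eq_bigr => j _.
by rewrite inE pair_in_exact // (negbTE NA) /= inE; case: (_ \in A).
Qed.

Lemma card_bd_Some (B : {set vert H}) :
  #|bd (Some @: B : {set vert add_apex})| = cut_weight T B.
Proof.
rewrite card_bd_apex; last by apply/imsetP => -[].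
by congr cut_weight; apply/setP => x; rewrite inE mem_imset //; apply: Some_inj.
Qed.

(** Every cut has a side without the apex: either all of [H], of weight [size T], or a set
    controlled by [stubbed5]. *)
Lemma apex_edge_connected : size T = 5 -> stubbed5 T -> edge_connected add_apex 5.
Proof.
move=> sT wT; apply/edge_connectedP => A.
wlog NA : A / None \notin A.
  case: (boolP (None \in A)) => NA W; last exact: W.
  move=> A0 AT; rewrite -bdC; apply: W; rewrite ?inE ?NA ?setC_eq0 //.
  by rewrite -setC_eq0 setCK.
move=> A0 AT; rewrite card_bd_apex //.
case: (eqVneq (Some @^-1: A) setT) => [->|BT]; first by rewrite cut_weightT sT.
apply: wT => //; have /set0Pn[[x|] xA] := A0; last by rewrite xA in NA.
by apply/set0Pn; exists x; rewrite inE.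
Qed.

Lemma deg_apex : deg (None : vert add_apex) = size T.
Proof.
rewrite /deg -bdC card_bd_apex ?inE //.
rewrite (_ : Some @^-1: _ = [set: vert H]) ?cut_weightT //.
by apply/setP => x; rewrite !inE.
Qed.

(** Orient all stubs away from the apex and add their effect to [beta]; in an extension this effect
    cancels, leaving a [beta]-orientation of [H]. *)
Lemma apex_extendable : Z3_extendable (None : vert add_apex) -> Z3_connected H.
Proof.
move=> ext beta bb.
pose F := bd [set None : vert add_apex].
pose Dx (e : edge add_apex) : vert add_apex := None.
have inF e : (e \in F) = (None \in ends e) by apply: in_bd1.
have oDx : orientation F Dx by move=> e; rewrite in_bd1.
pose b' (w : vert add_apex) : 'Z_3 :=
  ((if w is Some v then beta v else 0) + netdeg F Dx w)%R.
have bb' : boundary b'.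
  rewrite /boundary /b' big_split sum_netdeg //= addr0.
  rewrite (bigD1 None) //= add0r (reindex_omap Some id) => [|[]//].
  by rewrite -[RHS]bb; apply: eq_bigl => v; rewrite /= eqxx.
have [|D [[oD nD] DDx]] := ext b' bb' Dx oDx; first by rewrite /b' add0r.
have Dinl e : {v | D (inl e) = Some v & v \in ends e}.
  have := oD (inl e) (in_setT _); rewrite /= ; case: (D (inl e)) => [v|] DE.
    by exists v => //; move: DE; rewrite mem_imset //; apply: Some_inj.
  by exfalso; case/imsetP: DE.
pose D' e := s2val (Dinl e).
exists D'; split=> [e _|v]; first exact: s2valP' (Dinl e).
have := nD (Some v); rewrite netdegTE big_sumType /= /b' netdegE.
rewrite [X in (beta v + X)%R]big_mkcond big_sumType /=.
rewrite [X in (beta v + (X + _))%R]big1 => [|e _]; last first.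
  by have := inF (inl e); case: ifP => // _ /esym/imsetP[].
rewrite add0r [X in (beta v + X)%R](eq_bigr (fun j => flow D (inr j) (Some v))).
  move/addIr <-; rewrite netdegTE; apply: eq_bigr => e _; rewrite /flow /D'.
  case: (Dinl e) => /= w -> we; rewrite mem_imset //; exact: Some_inj.
move=> j _; have jF : inr j \in F by rewrite inF !inE.
by rewrite jF; apply: eq_flow; rewrite DDx.
Qed.

End AddVertex.

(** * Inductions by contraction *)

Lemma stub_connectedW m n : m <= n -> stub_connected n -> stub_connected m.
Proof. by move=> mn E H T Hm; apply: E; apply: leq_trans mn. Qed.

Lemma ess_stub_connected :
    (forall G : mgraph, edge_connected G 5 -> ess_edge_connected G 6 ->
       forall x : vert G, deg x = 5 -> Z3_extendable x) ->
  forall n, stub_connected n.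
Proof.
move=> bii; elim=> [|n IH] H T Hn sT wT.
  exact: Z3_connected_small (leq_trans Hn _).
case: (posnP #|vert H|) => [V0|/card_gt0P[v0 _]].
  by apply: Z3_connected_small; rewrite V0.
have {T sT wT} [T sT wT] := pad_stubs v0 sT wT.
have ec := apex_edge_connected sT wT.
case: (classic (ess_edge_connected (add_apex T) 6)) => [ess|ness].
  by apply: (apex_extendable (T := T)); apply: bii; rewrite ?deg_apex.
have [A [dA A0 AT nv]] : exists A : {set vert (add_apex T)},
    [/\ #|bd A| <= 5, A != set0, A != setT & forall v, bd A <> bd [set v]].
  apply: NNPP => no; apply: ness => t t6 C; rewrite inE.
  case/andP=> /eqP Ct /existsP[A /and3P[A0 AT /eqP CA]]; apply: NNPP => nv.
  apply: no; exists A; split=> //; first by rewrite -CA Ct.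
  by move=> v Av; apply: nv; exists v; rewrite CA.
(* Complementing puts the apex outside [A], so that [A] comes from a vertex set [B] of [H]. *)
wlog NA : A dA A0 AT nv / None \notin A.
  case: (boolP (None \in A)) => NA W; last exact: (W A).
  by apply: (W (~: A)); rewrite ?bdC ?inE ?NA ?setC_eq0 // -setC_eq0 setCK.
pose B := Some @^-1: A.
have AB : A = Some @: B.
  apply/setP => -[x|]; last by rewrite (negbTE NA); apply/esym/imsetP => -[].
  by rewrite mem_imset ?inE //; apply: Some_inj.
have B0 : B != set0 by apply: contraNneq A0 => B0; rewrite AB B0 imset0.
(* The cut is neither trivial at a vertex of [H] nor at the apex, hence [1 < #|B| < #|vert H|]; both
   [H[B]] and [H / B] are then smaller than [H]. *)
have B1 : 1 < #|B|.
  rewrite ltn_neqAle card_gt0 B0 andbT eq_sym; apply/cards1P => -[v Bv].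
  by apply: (nv (Some v)); rewrite AB Bv imset_set1.
have BT : #|B| < #|vert H|.
  rewrite -cardsT proper_card // properT; apply/eqP => BT.
  apply: (nv None); rewrite -[RHS]bdC; congr bd; apply/setP => -[x|].
    by rewrite AB BT mem_imset ?inE //; apply: Some_inj.
  by rewrite !inE (negbTE NA).
have wB : cut_weight T B <= 5 by rewrite -card_bd_Some -AB.
apply: (@Z3_connected_contract _ B _ (@induced_subset H B)).
  apply: (induced_Z3_connected (T := T)) wB _.
    by apply: stub_connectedW IH; rewrite -ltnS (leq_trans BT).
  move=> C C0 CB; apply: wT => //; apply: contraTneq CB => ->.
  by rewrite properE subsetT andbF.
apply: (IH (contract B) (map (contract_map B) T)); first by rewrite card_contract; lia.
  by rewrite size_map sT.
exact: stubbed5_contract.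
Qed.

Lemma reduced_Z3_connected :
    (forall G : mgraph, Z3_reduced G -> min_degree G <= 4) ->
  forall G : mgraph, edge_connected G 5 -> Z3_connected G.
Proof.
move=> c G; have [n] := ubnP #|vert G|; elim: n G => // n IH G Gn ec.
case: (classic (Z3_reduced G)) => [/c|].
  move=> md; apply: Z3_connected_small; apply: contraTT md; rewrite -!ltnNge => V2.
  have dv (v : vert G) : 5 <= deg v.
    move/edge_connectedP: ec; apply; first by rewrite -card_gt0 cards1.
    by apply: contraTneq V2 => vT; rewrite -cardsT -vT cards1.
  have /card_gt0P[v0 _] : 0 < #|vert G| by apply: leq_trans V2.
  (* The default [#|edge G|] of the minimum is at least 5 too, since it bounds the degree of
     [v0]. *)
  rewrite /min_degree; apply: (big_ind (leq 5)) => [|m k m5 k5|v _]; last exact: dv.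
    exact: leq_trans (dv v0) (max_card _).
  by rewrite leq_min m5.
move=> nred.
have [W [F [sFW [W2 ZF]]]] : exists (W : {set vert G}) (F : {set edge G})
    (sFW : forall e, e \in F -> ends e \subset W),
    2 <= #|vert (subgraph sFW)| /\ Z3_connected (subgraph sFW).
  apply: NNPP => no; apply: nred => W F sFW W2 ZF; apply: no.
  by exists W, F, sFW.
have {}W2 : 1 < #|W| by rewrite -(card_induced W).
have WV : #|W| <= #|vert G| by apply: max_card.
apply: (Z3_connected_contract ZF); apply: IH.
  by rewrite card_contract; lia.
by apply: edge_connected_contract => //; rewrite -card_gt0; lia.
Qed.

(** * Substituting copies of a graph into a host graph *)

Section Degrees.
Variables (G : mgraph) (D : edge G -> vert G).
Hypothesis oD : orientation [set: edge G] D.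

Lemma outdeg_indeg (v : vert G) :
  outdeg [set: edge G] D v + indeg [set: edge G] D v = deg v.
Proof.
rewrite /deg -(cardsID [set e | D e == v]); congr (_ + _); apply: eq_card => e.
  rewrite !in_setI in_bd1 !inE; case: eqP => [<-|]; rewrite ?andbF //.
  by rewrite oD ?inE.
by rewrite in_setD in_bd1 !inE /= [RHS]andbC.
Qed.

Lemma sum_outdeg : \sum_v outdeg [set: edge G] D v = #|edge G|.
Proof.
rewrite /outdeg; under eq_bigr do rewrite -sum_mem_card.
rewrite exchange_big -sum1_card /=; apply: congr_big => // [e|e _]; first by rewrite inE.
by rewrite (bigD1 (D e)) //= eqxx big1 // => v; rewrite eq_sym => /negbTE ->.
Qed.

End Degrees.

(* The vertices of the host [M] are replaced by copies of [H]; the edges of [M]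
   at [i] are attached to the copy [i] at the successive items of [T]. *)
Section Substitution.
Variables (M H : mgraph) (T : seq (vert H)) (v0 : vert H).

(** The edges at [i] are matched with the items of [T] by their rank in an enumeration; only the
    values at edges incident with [i] matter. *)
Definition slot (i : vert M) (e : edge M) : vert H :=
  nth v0 T (index e (enum (bd [set i]))).

Definition subst_ends (e : (vert M * edge H) + edge M) : {set vert M * vert H} :=
  match e with
  | inl (i, e) => pair i @: ends e
  | inr e => (fun i => (i, slot i e)) @: ends e
  end.

Lemma subst_slot_inj (e : edge M) : injective (fun i => (i, slot i e)).
Proof. by move=> i j []. Qed.

Lemma subst_copy_inj (i : vert M) : injective (pair i : vert H -> vert M * vert H).
Proof. by move=> v w []. Qed.

Lemma card_subst_ends e : #|subst_ends e| = 2.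
Proof.
case: e => [[i e]|e] /=; rewrite card_imset ?card_ends //.
  exact: subst_copy_inj.
exact: subst_slot_inj.
Qed.

Definition subst : mgraph := MGraph card_subst_ends.

Lemma card_bd_subst (A : {set vert subst}) :
  #|bd A| = \sum_i #|bd (pair i @^-1: A : {set vert H})| +
            \sum_e (#|ends e :&: [set i | (i, slot i e) \in A]| == 1).
Proof.
rewrite card_bdE big_sumType /=; congr (_ + _).
  under [RHS]eq_bigr do rewrite card_bdE.
  rewrite pair_big; apply: eq_bigr => -[i e] _.
  by rewrite !inE /= card_imset_capl // => v w _ _; apply: subst_copy_inj.
apply: eq_bigr => e _; rewrite !inE /= card_imset_capl; last first.
  by move=> i j _ _; apply: subst_slot_inj.
by congr (nat_of_bool (#|_| == 1)); apply/setP => i; rewrite !inE.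
Qed.

Lemma card_bd_subst_setXT (S : {set vert M}) :
  #|bd (setX S setT : {set vert subst})| = #|bd S|.
Proof.
rewrite card_bd_subst big1 ?add0n => [|i _].
  rewrite card_bdE; apply: eq_bigr => e _; rewrite inE.
  by congr (nat_of_bool (#|_ :&: _| == 1)); apply/setP => i; rewrite !inE andbT.
case: (boolP (i \in S)) => iS.
  rewrite (_ : _ @^-1: _ = setT) ?bdT ?cards0 //.
  by apply/setP => v; rewrite !inE iS.
rewrite (_ : _ @^-1: _ = set0) ?bd0 ?cards0 //.
by apply/setP => v; rewrite !inE (negbTE iS).
Qed.

Hypothesis degM : forall i : vert M, deg i = size T.

Lemma map_slot (i : vert M) : [seq slot i e | e <- enum (bd [set i])] = T.
Proof.
have sz : size (enum (bd [set i])) = size T by rewrite -cardE -(degM i).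
apply: (@eq_from_nth _ v0) => [|j]; rewrite size_map // => jT.
have e0 : edge M by case: (enum _) jT.
by rewrite (nth_map e0) // /slot index_uniq ?enum_uniq.
Qed.

Lemma sum_slot (i : vert M) (a : pred (vert H)) :
  \sum_(e | i \in ends e) (a (slot i e) : nat) = count a T.
Proof.
rewrite -(map_slot i) count_map -sum1_count big_enum_cond big_mkcond [RHS]big_mkcond.
by apply: eq_bigr => e _; rewrite in_bd1; case: (i \in ends e) => //=; case: (a _).
Qed.

Lemma card_bd_subst_set1X (i : vert M) (B : {set vert H}) :
  #|bd (setX [set i] B : {set vert subst})| = cut_weight T B.
Proof.
rewrite card_bd_subst (bigD1 i) //= big1 => [|j ji]; last first.
  rewrite (_ : _ @^-1: _ = set0) ?bd0 ?cards0 //.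
  by apply/setP => v; rewrite !inE (negbTE ji).
rewrite addn0; congr (_ + _).
  by congr (#|bd _|); apply/setP => v; rewrite !inE eqxx.
rewrite -(sum_slot i) [RHS]big_mkcond; apply: eq_bigr => e _.
case: (boolP (slot i e \in B)) => sB /=; last first.
  rewrite (_ : ends e :&: _ = set0) ?cards0.
    by rewrite /= (negbTE sB); case: ifP.
  apply/setP => j; rewrite !inE /=; case: eqP => [->|]; last by rewrite andbF.
  by rewrite (negbTE sB) /= andbF.
rewrite (_ : ends e :&: _ = ends e :&: [set i]); last first.
  by apply/setP => j; rewrite !inE /=; case: (eqVneq j i) => [->|]; rewrite ?sB.
rewrite sB; case: ifP => ie; first by rewrite (setIidPr _) ?cards1 // sub1set.
rewrite (_ : _ :&: _ = set0) ?cards0 //; apply/eqP.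
by rewrite setI_eq0 disjoint_sym disjoints1 ie.
Qed.

(** Induction on the number of copies that [A] splits. With none split, [A] gives a cut of [M].
    Otherwise uncross [A] with a whole split copy, whose boundary has 5 edges: the intersection lies
    in one copy and the union splits fewer copies. *)
Lemma edge_connected_subst : size T = 5 -> edge_connected M 5 -> stubbed5 T ->
  edge_connected subst 5.
Proof.
move=> sT /edge_connectedP ecM wT; apply/edge_connectedP.
pose cp (A : {set vert subst}) i : {set vert H} := pair i @^-1: A.
pose split (A : {set vert subst}) i := (cp A i != set0) && (cp A i != setT).
move=> A; have [n] := ubnP #|[set i | split A i]|.
elim: n A => // n IH A nA A0 AT.
have inside i B : B != set0 -> 5 <= #|bd (setX [set i] B : {set vert subst})|.
  move=> B0; rewrite card_bd_subst_set1X.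
  by case: (eqVneq B setT) => [->|BT]; [rewrite cut_weightT sT | apply: wT].
case: (pickP (split A)) => [i /andP[Ai0 AiT]|nospl]; last first.
  pose S := [set i | cp A i == setT].
  have AE : A = setX S setT.
    apply/setP => -[i v]; rewrite !inE andbT.
    have := nospl i; rewrite /split; case: eqP => [Ai _|_ /= /negPn/eqP Ai].
      rewrite Ai; have := congr1 (fun B : {set vert H} => v \in B) Ai.
      rewrite !inE => ->; apply/esym/negbTE/eqP => /setP/(_ v0).
      by rewrite !inE.
    rewrite Ai eqxx; have := congr1 (fun B : {set vert H} => v \in B) Ai.
    by rewrite !inE.
  rewrite AE card_bd_subst_setXT; apply: ecM.
    by apply: contraNneq A0 => S0; rewrite AE S0; apply/eqP/setP => -[j v]; rewrite !inE.
  by apply: contraNneq AT => S0; rewrite AE S0; apply/eqP/setP => -[j v]; rewrite !inE.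
pose Vi : {set vert subst} := setX [set i] setT.
have dVi : #|bd Vi| = 5 by rewrite card_bd_subst_setXT -/(deg i) degM.
(* Here the union bounds no cut, but the complement of [A] lies inside copy [i]. *)
case: (eqVneq (A :|: Vi) setT) => [AVT|AVT].
  rewrite -bdC (_ : ~: A = setX [set i] (~: cp A i)); last first.
    apply/setP => -[j v]; rewrite !inE; case: (eqVneq j i) => [->//|ji].
    have := congr1 (fun B : {set vert subst} => (j, v) \in B) AVT.
    by rewrite /= !inE (negbTE ji) orbF => ->.
  by apply: inside; rewrite setC_eq0.
have dI : 5 <= #|bd (A :&: Vi)|.
  rewrite (_ : A :&: Vi = setX [set i] (cp A i)) ?inside //.
  apply/setP => -[j v]; rewrite !inE.
  by case: (eqVneq j i) => [->|]; rewrite ?andbT ?andbF.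
have dU : 5 <= #|bd (A :|: Vi)|.
  apply: IH => //; last by rewrite setU_eq0 negb_and A0.
  rewrite -ltnS; apply: leq_trans nA; rewrite ltnS; apply: proper_card.
  apply/properP; split; last first.
    exists i; first by rewrite inE /split Ai0.
    rewrite inE /split negb_and !negbK; apply/orP; right; apply/eqP/setP => v.
    by rewrite !inE eqxx orbT.
  apply/subsetP => j; rewrite !inE /split; case: (eqVneq j i) => [->|ji].
    by rewrite Ai0 AiT.
  rewrite (_ : cp (A :|: Vi) j = cp A j) //.
  by apply/setP => v; rewrite !inE (negbTE ji) orbF.
have := bd_submod A Vi; rewrite dVi; lia.
Qed.

End Substitution.

Section SubstOrientation.
Variables (M H : mgraph) (T : seq (vert H)) (v0 : vert H).
Let Q := subst M T v0.
Variable D : edge Q -> vert Q.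
Hypothesis oD : orientation [set: edge Q] D.

Definition host_orientation (e : edge M) : vert M := (D (inr e)).1.
Definition copy_orientation (i : vert M) (e : edge H) : vert H := (D (inl (i, e))).2.

Lemma host_orientationP e :
  D (inr e) = (host_orientation e, slot T v0 (host_orientation e) e).
Proof.
have := oD (in_setT (inr e)); rewrite /host_orientation /=.
by case/imsetP => i _ ->.
Qed.

Lemma host_orientation_in : orientation [set: edge M] host_orientation.
Proof.
move=> e _; have := oD (in_setT (inr e)); rewrite /host_orientation /=.
by case/imsetP => i ie ->.
Qed.

Lemma copy_orientationP i e : D (inl (i, e)) = (i, copy_orientation i e).
Proof.
have := oD (in_setT (inl (i, e))); rewrite /copy_orientation /=.
by case/imsetP => v _ ->.
Qed.

Lemma copy_orientation_in i : orientation [set: edge H] (copy_orientation i).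
Proof.
move=> e _; have := oD (in_setT (inl (i, e))); rewrite /copy_orientation /=.
by case/imsetP => v ve ->.
Qed.

(** Besides the edges of its own copy, [(i, v)] meets exactly the host edges at [i] whose slot is
    [v]. *)
Lemma netdeg_subst (i : vert M) (v : vert H) :
  (netdeg [set: edge Q] D (i, v) = netdeg [set: edge H] (copy_orientation i) v +
   \sum_e (slot T v0 i e == v)%:R * flow host_orientation e i)%R.
Proof.
rewrite netdegTE big_sumType /=; congr (_ + _)%R.
  rewrite netdegTE.
  rewrite (eq_bigr (fun p : vert M * edge H =>
      if p.1 == i then flow (copy_orientation i) p.2 v else 0%R)).
    rewrite -(pair_big xpredT xpredT (fun j e =>
      if j == i then flow (copy_orientation i) e v else 0%R)) /=.
    rewrite (bigD1 i) //= eqxx [X in (_ + X)%R]big1 ?addr0 // => j /negbTE ->.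
    exact: big1.
  move=> [j e] _ /=; case: eqP => [->|/eqP ji].
    rewrite /flow copy_orientationP xpair_eqE eqxx /=.
    by rewrite mem_imset //; apply: subst_copy_inj.
  apply: flow_notin; first exact: oD.
  by apply: contra ji => /imsetP[w _ [-> _]].
apply: eq_bigr => e _; rewrite /flow host_orientationP xpair_eqE.
have -> : ((i, v) \in ends (inr e : edge Q)) = (i \in ends e) && (slot T v0 i e == v).
  apply/imsetP/andP => [[j je [-> ->]]|[ie /eqP sv]]; first by rewrite je.
  by exists i => //; rewrite sv.
case: (eqVneq (host_orientation e) i) => [->|hi] /=.
  by case: (slot T v0 i e == v); rewrite /= ?mul1r ?mul0r // !andbF subr0.
by case: (slot T v0 i e == v); rewrite /= ?mul1r ?mul0r ?andbT // !andbF subr0.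
Qed.

End SubstOrientation.

(** * The counting argument on K6 *)

Lemma complete6 : exists M : mgraph, [/\ #|vert M| = 6, #|edge M| = 15,
  forall i : vert M, deg i = 5 & edge_connected M 5].
Proof.
have c2 (e : {e : {set 'I_6} | #|e| == 2}) : #|val e| = 2 by apply/eqP/(valP e).
pose M := MGraph c2.
have dS (S : {set vert M}) : #|bd S| = #|S| * (6 - #|S|).
  have {2}-> : #|S| = 6 - #|~: S| by rewrite -[in LHS](setCK S) cardsCs !setCK card_ord.
  rewrite subKn; last by rewrite -[6]card_ord max_card.
  (* Edges are the 2-subsets, so those leaving [S] correspond to the pairs in [setX S (~: S)]. *)
  rewrite -cardsX -(card_imset _ val_inj).
  rewrite -(card_in_imset (f := fun p => [set p.1; p.2]) (D := setX S (~: S))); last first.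
    move=> [a b] [c d]; rewrite !inE /= => /andP[aS bS] /andP[cS dS] E.
    have : a \in [set c; d] by rewrite -E !inE eqxx.
    have : b \in [set c; d] by rewrite -E !inE eqxx orbT.
    rewrite !inE => /orP[] /eqP Eb /orP[] /eqP Ea; rewrite ?Ea ?Eb //.
    - by rewrite Eb cS in bS.
    - by rewrite Eb cS in bS.
    - by rewrite Ea (negbTE dS) in aS.
  apply: eq_card => X; apply/imsetP/imsetP.
    move=> [e eS ->]; have [u [v [uv ee]]] := @ends_pair M e.
    move: eS; rewrite (@in_bd M _ _ _ _ uv ee) => eS.
    case: (boolP (u \in S)) eS => uS vS.
      by exists (u, v); rewrite ?inE ?uS.
    exists (v, u); rewrite ?inE ?uS ?andbT //=.
    by rewrite setUC; exact: ee.
  move=> [[a b]]; rewrite !inE /= => /andP[aS bS] ->.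
  have ab : a != b by apply: contraNneq bS => <-.
  have c : #|[set a; b]| == 2 by rewrite cards2 ab.
  pose e : edge M := exist (fun e : {set 'I_6} => #|e| == 2) [set a; b] c.
  by exists e => //; rewrite (@in_bd M _ e a b) ?aS ?(negbTE bS).
exists M; split.
- by rewrite card_ord.
- rewrite card_sig -(@eq_card _ [set A : {set 'I_6} | #|A| == 2]) ?card_draws ?card_ord //.
  by move=> A; rewrite !inE.
- by move=> i; rewrite /deg dS cards1.
apply/edge_connectedP => S S0 ST; rewrite dS.
have : 0 < #|S| by rewrite card_gt0.
have : #|S| < 6 by rewrite -[6]card_ord -cardsT proper_card // properT.
nia.
Qed.

Lemma Z3_connected_stub :
    (forall G : mgraph, edge_connected G 5 -> Z3_connected G) ->
  forall n, stub_connected n.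
Proof.
move=> a n H T _ sT wT.
case: (posnP #|vert H|) => [V0|/card_gt0P[v0 _]].
  by apply: Z3_connected_small; rewrite V0.
have {T sT wT} [T sT wT] := pad_stubs v0 sT wT.
have [M [VM EM dM ecM]] := complete6.
have degM (i : vert M) : deg i = size T by rewrite dM sT.
have ZQ := a _ (edge_connected_subst v0 degM sT ecM wT).
move=> beta bb; apply: NNPP => nbeta.
have sum_count : (\sum_v (count_mem v T)%:R = 5%:R :> 'Z_3)%R.
  rewrite -natr_sum -sT; congr (_%:R)%R.
  elim: (T) => [|x s IH]; first by rewrite big1.
  rewrite /= big_split /= IH (bigD1 x) //= eqxx big1 // => v.
  by rewrite eq_sym => /negbTE ->.
(* The boundary that fits a [beta]-orientation of each copy with all its host edges pointing
   outwards. *)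
pose b' (p : vert (subst M T v0)) : 'Z_3 := (beta p.2 + (count_mem p.2 T)%:R)%R.
have sum_b' (i : vert M) : (\sum_v b' (i, v) = 5%:R)%R.
  by rewrite big_split /= bb sum_count add0r.
have bb' : boundary b'.
  rewrite /boundary (eq_bigr (fun p => b' (p.1, p.2))) => [|[]//].
  rewrite -(pair_big xpredT xpredT (fun i v => b' (i, v))) /=.
  rewrite (eq_bigr (fun=> 5%:R)%R) => [|i _]; last exact: sum_b'.
  (* The total is 6 * 5 = 30, which is 0 modulo 3. *)
  by rewrite sumr_const VM -mulrnA; apply: val_inj.
have [D [oD nD]] := ZQ _ bb'.
pose h := host_orientation D.
have oh : orientation [set: edge M] h := host_orientation_in oD.
(* Summed over a copy, the inner edges cancel and only the host edges at [i] remain. *)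
have net5 i : netdeg [set: edge M] h i = 5%:R%R.
  rewrite -(sum_b' i) -(eq_bigr _ (fun v _ => nD (i, v))).
  under eq_bigr do rewrite (netdeg_subst oD).
  rewrite big_split /= sum_netdeg ?add0r; last exact: copy_orientation_in.
  rewrite exchange_big netdegTE /=; apply: eq_bigr => e _.
  rewrite -mulr_suml (bigD1 (slot T v0 i e)) //= eqxx big1 ?addr0 ?mul1r // => v.
  by rewrite eq_sym => /negbTE ->.
(* Five outgoing edges account exactly for the added stub counts, so the copy itself would carry a
   [beta]-orientation. *)
have out5 i : outdeg [set: edge M] h i != 5.
  apply/eqP => o5; apply: nbeta; exists (copy_orientation D i).
  split=> [|v]; first exact: copy_orientation_in.
  have := nD (i, v); rewrite (netdeg_subst oD) /b' /= -(sum_slot v0 degM i (pred1 v)).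
  rewrite natr_sum [X in (_ = _ + X)%R](_ : _ =
    \sum_e (slot T v0 i e == v)%:R * flow h e i)%R; first exact: addIr.
  rewrite big_mkcond; apply: eq_bigr => e _.
  have i0 : indeg [set: edge M] h i = 0 by have := outdeg_indeg oh i; rewrite o5 dM; lia.
  have := card0_eq i0 e; rewrite !inE /= => ie.
  case: ifP => [ei|/negbT ne]; last by rewrite flow_notin ?mulr0 // oh.
  by rewrite /flow ie; move: ie; rewrite ei => /negbFE ->; rewrite subr0 mulr1.
(* With [o] edges out and [5 - o] in, 2o - 5 = 5 modulo 3 forces [o] to be 2 or 5. *)
have out2 i : outdeg [set: edge M] h i = 2.
  have := out5 i; have := net5 i; have := outdeg_indeg oh i; rewrite dM /netdeg.
  move: (outdeg _ _ _) (indeg _ _ _) => o k ok.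
  have -> : k = 5 - o by lia.
  have : o <= 5 by lia.
  by case: o {ok} => [|[|[|[|[|[|o]]]]]].
(* The out-degrees add up to 6 * 2 = 12, but K6 has 15 edges. *)
have := sum_outdeg h; rewrite (eq_bigr (fun=> 2)) // sum_nat_const VM EM.
by [].
Qed.

(** * The cycle of implications *)

Theorem theorem1p2 :
  [<-> (* a *)
       forall G : mgraph, edge_connected G 5 -> Z3_connected G;
       (* b-i *)
       forall G : mgraph, edge_connected G 5 ->
         forall x : vert G, deg x = 5 -> Z3_extendable x;
       (* b-ii *)
       forall G : mgraph, edge_connected G 5 -> ess_edge_connected G 6 ->
         forall x : vert G, deg x = 5 -> Z3_extendable x;
       (* c *)
       forall G : mgraph, Z3_reduced G -> min_degree G <= 4;
       (* d *)
       forall G : mgraph, edge_connected G 4 -> #|kcuts G 4| <= 5 ->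
         Z3_connected G].
Proof.
have d_a : (forall G : mgraph, edge_connected G 4 -> #|kcuts G 4| <= 5 ->
      Z3_connected G) ->
    forall G : mgraph, edge_connected G 5 -> Z3_connected G.
  move=> d G ec; apply: d => [t t4|]; first by apply: ec; apply: ltn_trans t4 _.
  by rewrite ec // cards0.
(* The arrows follow the listed order. All pass through (E) except (b-i) to (b-ii), a restriction,
   and (d) to (a), where there is no 4-cut; (c) first yields (a), and then (E). *)
tfae.
- by move=> /Z3_connected_stub E G ec x; apply: stub_extendable.
- by move=> bi G ec _; apply: bi.
- by move=> /ess_stub_connected E; apply: stub_min_degree.
- by move=> /reduced_Z3_connected/Z3_connected_stub E; apply: stub_few_4cuts.
- exact: d_a.
Qed.
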